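(* Let $n \geq 2$ and $l \geq 1$ be integers. Then $$h_l(n)\log n = \sum_{\substack{d^i \mid n \\ d\geq 2}} \ \sum_{j=1}^{l} (-1)^{j+1}\binom{i}{j}\, h_{l-j}(n/d^i)\,\log d,$$ where the outer sum runs over all pairs $(d,i)$ of integers with $d\geq 2$, $i\geq 1$ and $d^i\mid n$, and where the boundary values (the cases $n=1$ or $l=0$) are $$h_l(n)=\begin{cases}1, & \text{if } n=1 \text{ and } l=0;\\ 0, & \text{otherwise.}\end{cases}$$
   Context: A factorization of $n$ is unordered: it is a finite multiset of integers (its parts) whose product is $n$. For $n\geq 2$ and $l\geq 1$, $h_l(n)$ denotes the number of factorizations of $n$ into parts $\geq 2$ in which exactly $l$ different part values occur (each value may be repeated any number of times). For example, $h_2(36)=6$, counting $(18,2),(9,4),(12,3),(9,2,2),(3,3,4),(3,3,2,2)$. The binomial coefficient $\binom{i}{j}$ is $0$ for $j>i$. *)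

(* Defs.v *)
From mathcomp Require Import all_boot all_order all_algebra.
From mathcomp Require Import finmap multiset.
From mathcomp Require Import all_classical all_reals all_analysis.

Set Implicit Arguments.
Unset Strict Implicit.
Unset Printing Implicit Defensive.

Local Open Scope classical_set_scope.
Local Open Scope fset_scope.
Local Open Scope mset_scope.
Local Open Scope nat_scope.

Definition is_factorization (n : nat) (A : {mset nat}) : Prop :=
  (forall p, p \in A -> 2 <= p) /\ \prod_(p <- A) p = n.

(* [finsupp A] is the set of the distinct values occurring in [A]. *)
Definition factorizations (l n : nat) : set {mset nat} :=
  [set A | is_factorization n A /\ #|` finsupp A| = l].

(* [fset_set] is the empty set on infinite sets, but [factorizations l n] is
   always finite, see [finite_factorizations] below.
   The boundary values agree with the count, the empty multiset being the only
   factorization of 1. *)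
Definition h (l n : nat) : nat :=
  if (n == 1) || (l == 0) then nat_of_bool ((n == 1) && (l == 0))
  else #|` fset_set (factorizations l n)|.

(* Finite for n > 0, see [finite_power_divisors] below, so a finitely supported
   sum over it is the actual sum. *)
Definition power_divisors (n : nat) : set (nat * nat) :=
  [set di | [/\ 2 <= di.1, 1 <= di.2 & di.1 ^ di.2 %| n]].

Lemma factorization_gt0 n A : is_factorization n A -> 0 < n.
Proof.
move=> [A2 <-]; rewrite big_seq prodn_cond_gt0 // => p pA.
exact: ltn_trans (A2 p pA).
Qed.

Lemma factorization_size n A : is_factorization n A -> 2 ^ size A <= n.
Proof.
move=> [A2 <-]; have {A2} : forall p, p \in enum_mset A -> 2 <= p by [].
elim: (enum_mset A) => [|x s IHs] s2; first by rewrite big_nil.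
rewrite big_cons /= expnS leq_mul ?s2 ?mem_head // IHs // => p ps.
by rewrite s2 // inE ps orbT.
Qed.

Lemma factorization_dvd n A p : is_factorization n A -> p \in A -> p %| n.
Proof. by move=> [_ <-] pA; rewrite (big_rem p) //= dvdn_mulr. Qed.

Lemma finite_factorizations l n : finite_set (factorizations l n).
Proof.
pose g (F : {ffun 'I_n.+1 -> 'I_n.+1}) : {mset nat} :=
  [fsfun x in [fset x in iota 0 n.+1] => nat_of_ord (F (inord x))].
apply: (@sub_finite_set _ _ (g @` setT)); last first.
  exact/finite_image/finite_finset.
move=> A [Af _]; have n_gt0 := factorization_gt0 Af.
exists [ffun i : 'I_n.+1 => inord (A i)] => //.
apply/fsfunP => x; rewrite fsfunE in_fset mem_iota leq0n add0n /=.
case: ltnP => [x_le|x_gt].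
  have Ax_le : A x <= n.
    apply: leq_trans (factorization_size Af).
    apply: leq_trans (ltnW (ltn_expl _ (ltnSn 1))).
    by rewrite -count_mem_mset count_size.
  by rewrite ffunE !inordK.
apply/esym/mset_eq0P/negP => xA.
have := dvdn_leq n_gt0 (factorization_dvd Af xA).
by rewrite leqNgt x_gt.
Qed.

Lemma finite_power_divisors n : 0 < n -> finite_set (power_divisors n).
Proof.
move=> n_gt0; apply: (@sub_finite_set _ _ (`I_n.+1 `*` `I_n.+1)); last first.
  by apply: finite_setX; exact: finite_II.
move=> [d i] [/= d2 i1 /(dvdn_leq n_gt0) dn]; split=> /=; rewrite ltnS.
  by apply: leq_trans dn; rewrite -[leqLHS]expn1 leq_exp2l.
by apply: leq_trans dn; rewrite ltnW // ltn_expl.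
Qed.

(* Main.v *)
Require Import Defs.
From mathcomp Require Import all_boot all_order all_algebra.
From mathcomp Require Import finmap multiset.
From mathcomp Require Import all_classical all_reals all_analysis.

(** Taking logarithms in a factorization [A] of [n] gives
    ln n = \sum_d A(d) ln d, where A(d) is the multiplicity of [d] in [A].
    Summed over all [A] with [l] distinct parts, this turns h_l(n) ln n into
    \sum_d ln d \sum_A A(d), so it suffices to evaluate the total
    multiplicity \sum_A A(d) for each fixed [d] (lemma [alternating_sum_h]).

    Adjoining [i] copies of [d] to a factorization of n/d^i with [k] distinct
    parts yields a factorization of [n] in which [d] occurs at least [i]
    times: exactly [i] times if [d] is a new part, and then there are [k+1]
    distinct parts; more than [i] times otherwise, and then there are still
    [k]. This is reversible, which is [h_adjoin].  Weighting it by
    binom(i, j), for j >= 1, and summing over i >= 1 with d^i dividing [n]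
    gives, by the hockey-stick identity,

      \sum_i binom(i, j) h_k(n/d^i) = M(k+1, j) + M(k, j+1),

    where M(k, j) is the sum of binom(A(d), j) over the factorizations [A] of
    [n] with [k] distinct parts ([sum_h_binomial]).  With k = l - j, the two
    terms on the right are consecutive values of M(l+1-j, j), so the
    alternating sum over [j] telescopes.  What remains is M(l, 1), the desired
    total multiplicity, and M(0, l+1), which vanishes since a factorization
    without parts does not contain [d]. *)

Import Order.TTheory GRing.Theory Num.Theory.

Local Open Scope classical_set_scope.
Local Open Scope ring_scope.

(** * Adjoining copies of a part *)

Section Combinatorics.
Local Open Scope fset_scope.
Local Open Scope mset_scope.
Local Open Scope nat_scope.

Lemma perm_enum_msetD (K : choiceType) (A B : {mset K}) :
  perm_eq (enum_mset (A `+` B)) (enum_mset A ++ enum_mset B).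
Proof.
by apply/allP => x _; rewrite /= count_cat !count_mem_mset msetE2.
Qed.

Lemma is_factorization_adjoin n d i B : 2 <= d -> d ^ i %| n ->
  is_factorization n (B `+` msetn i d) <-> is_factorization (n %/ d ^ i) B.
Proof.
move=> d2 din; have di_gt0 : 0 < d ^ i by rewrite expn_gt0 (ltnW d2).
have prodE : \prod_(p <- B `+` msetn i d) p = (\prod_(p <- B) p) * d ^ i.
  by rewrite (perm_big _ (perm_enum_msetD _ _ _)) big_cat /= big_msetn.
split=> -[B2 prodB]; split=> [p|].
- by move=> pB; apply: B2; rewrite in_msetD pB.
- by rewrite -prodB prodE mulnK.
- by rewrite in_msetD in_msetn => /orP[/B2//|/andP[_ /eqP->]].
- by rewrite prodE prodB divnK.
Qed.

Lemma card_finsupp_adjoin (K : choiceType) (B : {mset K}) (d : K) i : 0 < i ->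
  #|` finsupp (B `+` msetn i d)| = (d \notin B) + #|` finsupp B|.
Proof.
move=> i_gt0; rewrite -msuppE -cardfsU1; congr (#|` _ |).
apply/fsetP => x; rewrite in_fsetU in_fset1 !msuppE in_msetD in_msetn i_gt0.
by rewrite orbC.
Qed.

Lemma in_factorizations l n (A : {mset nat}) :
  reflect (is_factorization n A /\ #|` finsupp A| = l)
          (A \in fset_set (factorizations l n)).
Proof.
by rewrite in_fset_set; [apply: (iffP idP); rewrite inE|exact: finite_factorizations].
Qed.

(** The boundary values prescribed for [h] are the actual counts, so that no
    case distinction on [k] or on n/d^i is needed below. *)
Lemma h_card l n : 0 < n -> h l n = #|` fset_set (factorizations l n)|.
Proof.
move=> n_gt0; rewrite /h; case: ifP => // bd.
have f1 A : is_factorization 1 A -> A = mset0.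
  move=> Af; have [//|[p pA]] := mset_0Vmem A.
  by have := Af.1 _ pA; have := factorization_dvd Af pA; rewrite dvdn1 => /eqP->.
have f0 A : #|` finsupp A| = 0 -> A = mset0 :> {mset nat}.
  move/cardfs0_eq => A0; apply/msetP => x; rewrite mset0E.
  by apply/eqP; rewrite mset_eq0 -msuppE A0 in_fset0.
have p0 : is_factorization 1 mset0.
  by split=> [p|]; rewrite ?in_mset0// big_mset0.
have s0 : #|` finsupp (mset0 : {mset nat})| = 0.
  by apply/eqP; rewrite cardfs_eq0; apply/eqP/fsetP => x; rewrite msuppE in_mset0.
case: (altP andP) => /= [[/eqP-> /eqP->]|nb].
  rewrite (_ : fset_set _ = [fset mset0]) ?cardfs1 //.
  apply/fsetP => A; rewrite in_fset1; apply/in_factorizations/eqP => [[/f1//]|->].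
  by [].
rewrite (_ : fset_set _ = fset0) ?cardfs0 //.
apply/fsetP => A; rewrite in_fset0; apply/negP => /in_factorizations[Af Al].
case/orP: bd => [/eqP n1|/eqP l0]; case/negP: nb; apply/andP; split; apply/eqP => //.
  by rewrite -Al (f1 A) ?s0 // -n1.
by case: Af => _; rewrite (f0 A) ?Al // big_mset0.
Qed.

(** The bijection at the heart of the proof: [B] is sent to [B] with [i] more
    copies of [d], and the two sums record whether [d] was absent from [B] or
    already one of its parts. *)
Lemma h_adjoin k n d i : 0 < n -> 2 <= d -> 0 < i -> d ^ i %| n ->
  h k (n %/ d ^ i) =
    \sum_(A <- fset_set (factorizations k.+1 n)) (A d == i)
    + \sum_(A <- fset_set (factorizations k n)) (i < A d).
Proof.
move=> n_gt0 d2 i_gt0 din.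
have di_gt0 : 0 < d ^ i by rewrite expn_gt0 (ltnW d2).
have m_gt0 : 0 < n %/ d ^ i by rewrite divn_gt0 // dvdn_leq.
rewrite h_card //.
(* Both sums are cardinals of sets of multisets; the images of the map fill
   exactly the disjoint union of these two sets. *)
have cardE (X : {fset {mset nat}}) P :
    \sum_(A <- X) (nat_of_bool (P A)) = #|` [fset A in X | P A]|.
  rewrite card_fset_sum1 -big_fset_condE [RHS]big_mkcond /=.
  by apply: eq_bigr => A _; case: (P A).
rewrite !cardE.
have adj_inj : injective (fun B : {mset nat} => B `+` msetn i d).
  exact: can_inj (msetDKBC _).
set F := fset_set (factorizations k (n %/ d ^ i)).
have <- : #|` [fset B `+` msetn i d | B in F]| = #|` F| by rewrite card_imfset.
set X := [fset A in _ | _]; set Y := [fset A in _ | _].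
have XY : (X `&` Y)%fset = fset0.
  apply/fsetP => A; rewrite !inE; apply/negP => /andP[/andP[_ /eqP->]].
  by rewrite ltnn andbF.
rewrite -cardfsUI XY cardfs0 addn0; congr (#|` _ |).
apply/fsetP => A; rewrite in_fsetU.
apply/imfsetP/orP => [[B /= /in_factorizations[Bf Bk] ->]|AXY].
  have Af := (is_factorization_adjoin _ _ _ B d2 din).2 Bf.
  have Ac := card_finsupp_adjoin _ B d _ i_gt0.
  have AdE : (B `+` msetn i d) d = B d + i by rewrite msetE2 msetnxx.
  case: (boolP (d \in (B : {mset nat}))) => dB; [right|left]; rewrite !inE AdE /=.
    rewrite -[X in X < _]add0n ltn_add2r mset_gt0 dB andbT.
    by apply/in_factorizations; rewrite Ac dB Bk.
  rewrite -[X in _ == X]add0n eqn_add2r mset_eq0 dB andbT.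
  by apply/in_factorizations; rewrite Ac dB Bk.
have Ai : i <= A d by case: AXY; rewrite !inE => /andP[_]; [move/eqP->|move/ltnW].
have AE : A = (A `\` msetn i d) `+` msetn i d.
  rewrite msetBDK //; apply/msubsetP => x; rewrite msetnE.
  by case: eqP => [->|].
exists (A `\` msetn i d) => //=; apply/in_factorizations.
have dB : (d \in A `\` msetn i d) = (i < A d) by rewrite in_msetB msetnxx.
have Ac := card_finsupp_adjoin _ (A `\` msetn i d) d _ i_gt0.
rewrite -AE dB in Ac.
case: AXY; rewrite !inE => /andP[/in_factorizations[Af Ak] Adi].
  split; first by apply/is_factorization_adjoin => //; rewrite -AE.
  by move: Ac; rewrite Ak (eqP Adi) ltnn => -[].
split; first by apply/is_factorization_adjoin => //; rewrite -AE.
by move: Ac; rewrite Ak Adi.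
Qed.

(** * Binomial moments of the multiplicity *)

Definition binomial_moment (n d k j : nat) : nat :=
  \sum_(A <- fset_set (factorizations k n)) 'C(A d, j).

Lemma expn_multiplicity_dvd n (A : {mset nat}) d : is_factorization n A -> d ^ A d %| n.
Proof.
move=> [_ <-]; rewrite prod_mset; case: (boolP (d \in A)) => dA.
  by rewrite (big_fsetD1 d) ?msuppE //= dvdn_mulr.
by rewrite (mset_eq0P dA) dvd1n.
Qed.

Lemma hockey_stick_sum j m : \sum_(0 <= i < m) 'C(i, j) = 'C(m, j.+1).
Proof.
elim: m => [|m IH]; first by rewrite big_geq.
by rewrite big_nat_recr //= IH binS addnC.
Qed.

Lemma multiplicity_leq n (A : {mset nat}) d : 2 <= d -> is_factorization n A -> A d <= n.
Proof.
move=> d2 Af; have n_gt0 := factorization_gt0 Af.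
apply: leq_trans (dvdn_leq n_gt0 (expn_multiplicity_dvd _ _ d Af)).
exact: ltnW (ltn_expl _ d2).
Qed.

(** In the sum of [h_adjoin] over [i], a factorization [A] with [k+1] distinct
    parts is counted for i = A(d) only, whereas one with [k] distinct parts is
    counted for every i < A(d) and so collects binom(A(d), j+1). The terms
    i = 0 may be added for this because [j] is positive. *)
Lemma sum_h_binomial n d k j : 0 < n -> 2 <= d -> 0 < j ->
  \sum_(1 <= i < n.+1 | d ^ i %| n) 'C(i, j) * h k (n %/ d ^ i) =
  binomial_moment n d k.+1 j + binomial_moment n d k j.+1.
Proof.
move=> n_gt0 d2 j_gt0.
pose a i := \sum_(A <- fset_set (factorizations k.+1 n)) (A d == i).
pose b i := \sum_(A <- fset_set (factorizations k n)) (i < A d).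
(* When d^i does not divide n, no multiplicity A(d) reaches i, so a i and b i
   vanish and the divisibility condition can be dropped. *)
transitivity (\sum_(0 <= i < n.+1) ('C(i, j) * a i + 'C(i, j) * b i)).
  rewrite [RHS]big_ltn // bin0n gtn_eqF // !mul0n !add0n.
  rewrite big_mkcond big_nat [RHS]big_nat; apply: eq_bigr => i /andP[i1 _].
  case: ifP => din; first by rewrite h_adjoin // mulnDr.
  rewrite /a /b !big_seq !big1 ?muln0 // => A /in_factorizations[Af _];
    have Adn := expn_multiplicity_dvd _ _ d Af.
    case: ltnP => // /ltnW iA.
    by rewrite (dvdn_trans (dvdn_exp2l d iA) Adn) in din.
  by case: eqP => // Ai; rewrite -Ai Adn in din.
rewrite big_split /= /a /b /binomial_moment; congr (_ + _).
  under eq_bigr do rewrite big_distrr /=.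
  rewrite exchange_big /= big_seq [RHS]big_seq; apply: eq_bigr => A.
  move=> /in_factorizations[Af _]; have An := multiplicity_leq _ _ _ d2 Af.
  rewrite (big_cat_nat _ (n := A d)) //= 1?ltnW // [X in _ + X]big_ltn //.
  rewrite eqxx muln1 !big_nat !big1 ?addn0 // => i /andP[iA iB].
    by rewrite ltn_eqF // muln0.
  by rewrite gtn_eqF // muln0.
under eq_bigr do rewrite big_distrr /=.
rewrite exchange_big /= big_seq [RHS]big_seq; apply: eq_bigr => A.
move=> /in_factorizations[Af _]; have An := multiplicity_leq _ _ _ d2 Af.
rewrite (big_cat_nat _ (n := A d)) //= 1?ltnW // -hockey_stick_sum.
rewrite [X in _ + X]big_nat [X in _ + X]big1 => [|i /andP[iA _]].
  rewrite addn0 big_nat [RHS]big_nat; apply: eq_bigr => i /andP[_ ->].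
  by rewrite muln1.
by rewrite ltnNge iA muln0.
Qed.

Lemma binomial_moment_support0 n d j : binomial_moment n d 0 j.+1 = 0.
Proof.
rewrite /binomial_moment big_seq big1 // => A /in_factorizations[_ A0].
by rewrite (mset_eq0P _) // -msuppE (cardfs0_eq A0) in_fset0.
Qed.

End Combinatorics.

(** * Telescoping and logarithms *)

Section Logarithm.

Lemma alternating_sum_h (R : realType) n l d :
  (0 < n)%N -> (2 <= d)%N -> (1 <= l)%N ->
  \sum_(1 <= i < n.+1 | (d ^ i %| n)%N) \sum_(1 <= j < l.+1)
     (-1) ^+ j.+1 * 'C(i, j)%:R * (h (l - j) (n %/ d ^ i)%N)%:R
  = (\sum_(A <- fset_set (factorizations l n)) A d)%:R :> R.
Proof.
move=> n_gt0 d2 l_gt0.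
(* The j-th summand of the exchanged sum is f (j + 1) - f j. *)
pose f j : R := (-1) ^+ j * (binomial_moment n d (l.+1 - j) j)%:R.
rewrite exchange_big /= (eq_big_nat _ _ (F2 := fun j => f j.+1 - f j)); last first.
  move=> j /andP[j_gt0]; rewrite ltnS => jl.
  under eq_bigr do rewrite -mulrA -natrM.
  rewrite -mulr_sumr -natr_sum sum_h_binomial // natrD /f subSS subSn //.
  by rewrite mulrDr addrC exprS !mulN1r !mulNr.
rewrite telescope_sumr // /f subnn binomial_moment_support0 mulr0 sub0r.
rewrite expr1 mulN1r opprK subn1 /binomial_moment /=.
by congr (_%:R); apply: eq_bigr => A _; rewrite bin1.
Qed.

Lemma ln_factorization (R : realType) n (A : {mset nat}%mset) : is_factorization n A ->
  ln (n%:R : R) = \sum_(2 <= d < n.+1) (A d)%:R * ln (d%:R : R).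
Proof.
move=> Af.
have -> : ln (n%:R : R) = \sum_(p <- A) ln (p%:R : R).
  case: Af => A2 <-; have {A2} : forall p, p \in enum_mset A -> (2 <= p)%N by [].
  elim: (enum_mset A) => [|x s IHs] s2; first by rewrite !big_nil ln1.
  have s2' p : p \in s -> (2 <= p)%N by move=> ps; rewrite s2 // inE ps orbT.
  rewrite !big_cons natrM lnM ?posrE ?ltr0n.
  - by rewrite IHs.
  - by rewrite ltnW ?s2 ?mem_head.
  - by rewrite big_seq prodn_cond_gt0 // => p /s2' /ltnW.
(* Each ln p is rewritten as a sum over d = p, so that exchanging the sums
   counts the occurrences of d in A. *)
transitivity (\sum_(p <- A) \sum_(2 <= d < n.+1 | d == p) ln (d%:R : R)).
  rewrite big_seq [RHS]big_seq; apply: eq_bigr => p pA.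
  rewrite big_nat1_eq ifT // (Af.1 p pA) ltnS dvdn_leq //.
    exact: factorization_gt0 Af.
  exact: factorization_dvd Af pA.
rewrite (exchange_big_dep xpredT) //=; apply: eq_bigr => d _.
rewrite big_const_seq iter_addr_0 -count_mem_mset.
by rewrite mulr_natl; congr (_ *+ _); apply: eq_count => p; rewrite /= eq_sym.
Qed.

(** The bound n on both components is harmless: d^i %| n forces d, i <= n. *)
Lemma sum_power_divisors (V : nmodType) n (F : nat * nat -> V) : (0 < n)%N ->
  \sum_(di \in power_divisors n) F di =
  \sum_(2 <= d < n.+1) \sum_(1 <= i < n.+1 | (d ^ i %| n)%N) F (d, i).
Proof.
move=> n_gt0.
pose s := [seq di : nat * nat <-
  [seq (d, i) | d <- index_iota 2 n.+1, i <- index_iota 1 n.+1]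
  | (di.1 ^ di.2 %| n)%N].
have s_uniq : uniq s.
  by rewrite filter_uniq // allpairs_uniq ?iota_uniq // => -[? ?] [? ?].
have -> : power_divisors n = [set` s].
  apply/seteqP; split=> -[d i] /=; rewrite mem_filter /=.
    move=> [/= d2 i1 din]; rewrite din /=; apply/allpairsP; exists (d, i).
    have le_n := dvdn_leq n_gt0 din.
    split=> //=; rewrite mem_index_iota ltnS ?d2 ?i1 /=.
      by apply: leq_trans le_n; rewrite -[X in (X <= _)%N]expn1 leq_exp2l.
    by apply: leq_trans le_n; exact: ltnW (ltn_expl _ d2).
  move=> /andP[din /allpairsP[[d' i'] /= [+ + [dE iE]]]].
  rewrite -dE -iE !mem_index_iota.
  by move=> /andP[d2 _] /andP[i1 _]; split.
rewrite -fsbig_seq // big_filter big_mkcond big_allpairs /=.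
by apply: eq_bigr => d _; rewrite [RHS]big_mkcond.
Qed.

End Logarithm.

Theorem theorem2 (R : realType) (n l : nat) (hn : (2 <= n)%N) (hl : (1 <= l)%N) :
  (h l n)%:R * ln (n%:R : R) =
  \sum_(di \in power_divisors n)
    \sum_(1 <= j < l.+1)
      (-1) ^+ j.+1 * 'C(di.2, j)%:R * (h (l - j) (n %/ di.1 ^ di.2)%N)%:R
        * ln (di.1%:R : R).
Proof.
have n_gt0 : (0 < n)%N by exact: ltnW.
transitivity (\sum_(2 <= d < n.+1)
    (\sum_(A <- fset_set (factorizations l n)) A d)%:R * ln (d%:R : R)).
  rewrite h_card // finmap.card_fset_sum1 natr_sum mulr_suml.
  under [RHS]eq_bigr do rewrite natr_sum mulr_suml.
  rewrite [RHS]exchange_big /= big_seq [RHS]big_seq; apply: eq_bigr => A.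
  by move=> /in_factorizations[Af _]; rewrite mul1r; exact: ln_factorization.
rewrite sum_power_divisors //=.
rewrite big_nat [RHS]big_nat; apply: eq_bigr => d /andP[d2 _].
rewrite -alternating_sum_h // mulr_suml /=.
by apply: eq_bigr => i _; rewrite mulr_suml.
Qed.
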